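(* Let $n\ge 1$ be an integer, let $K>1$, and let $\varphi:\mathbb{R}^n\to\mathbb{R}$ be a function in $E^{\mathrm{soft}}(n,K)$. Then $$\frac{K+1}{K}\bigl(\varphi(y)-\varphi(x)-p\cdot(y-x)\bigr)\ \le\ (p-q)\cdot(x-y)\ \le\ (K+1)\bigl(\varphi(y)-\varphi(x)-p\cdot(y-x)\bigr)$$ for every $x,y\in\mathbb{R}^n$, every $p\in\partial\varphi(x)$ and every $q\in\partial\varphi(y)$.
   Context: For a convex function $\varphi:\mathbb{R}^n\to\mathbb{R}$ and $x_0\in\mathbb{R}^n$, the subdifferential is $\partial\varphi(x_0)=\{p\in\mathbb{R}^n:\ \varphi(x)\ge\varphi(x_0)+p\cdot(x-x_0)\ \ \forall x\in\mathbb{R}^n\}$. For $x_0\in\mathbb{R}^n$, $p\in\partial\varphi(x_0)$ and $s>0$, the section of $\varphi$ at $(x_0,p)$ with height $s$ is $$S_\varphi(x_0,p,s)=\{x\in\mathbb{R}^n:\ \varphi(x)-\varphi(x_0)-p\cdot(x-x_0)<s\}.$$ For $K>1$, $E^{\mathrm{soft}}(n,K)$ denotes the class of convex functions $\varphi:\mathbb{R}^n\to\mathbb{R}$ having the soft engulfing property with constant $K$: for any $x\in\mathbb{R}^n$, $p\in\partial\varphi(x)$ and $t>0$, if $y\in S_\varphi(x,p,t)$, then $x\in S_\varphi(y,q,Kt)$ for every $q\in\partial\varphi(y)$. Neither differentiability of $\varphi$ nor boundedness of its sections is required in this definition. *)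

(* Defs.v *)
From mathcomp Require Import all_boot all_order all_algebra.
From mathcomp Require Import classical_sets reals convex.

Set Implicit Arguments.
Unset Strict Implicit.
Unset Printing Implicit Defensive.

Import Order.TTheory GRing.Theory Num.Theory.
Local Open Scope classical_set_scope.
Local Open Scope ring_scope.

(* The library's dot product dotmx needs a numClosedFieldType, which excludes
   the reals. *)
Definition dot (R : realType) (n : nat) (u v : 'rV[R]_n) : R :=
  \sum_(i < n) u 0 i * v 0 i.

Definition subdifferential (R : realType) (n : nat) (phi : 'rV[R]_n -> R)
    (x0 : 'rV[R]_n) : set 'rV[R]_n :=
  [set p | forall x, phi x >= phi x0 + dot p (x - x0)].

(* Total in p and s; only meaningful for p in subdifferential phi x0, s > 0. *)
Definition section (R : realType) (n : nat) (phi : 'rV[R]_n -> R)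
    (x0 p : 'rV[R]_n) (s : R) : set 'rV[R]_n :=
  [set x | phi x - phi x0 - dot p (x - x0) < s].

Definition soft_engulfing (R : realType) (n : nat) (K : R)
    (phi : 'rV[R]_n -> R) : Prop :=
  forall (x p : 'rV[R]_n) (t : R), subdifferential phi x p -> 0 < t ->
  forall y : 'rV[R]_n, section phi x p t y ->
  forall q : 'rV[R]_n, subdifferential phi y q -> section phi y q (K * t) x.

Definition Esoft (R : realType) (n : nat) (K : R) : set ('rV[R]_n -> R) :=
  [set phi | convex_function [set: convex_lmodType 'rV[R]_n] phi
             /\ soft_engulfing K phi].
Arguments Esoft {R} n K _.

(* Main.v *)
Require Import Defs.
From mathcomp Require Import all_boot all_order all_algebra.
From mathcomp Require Import classical_sets reals convex.
From mathcomp Require Import ring lra.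

Import Order.TTheory GRing.Theory Num.Theory.
Local Open Scope classical_set_scope.
Local Open Scope ring_scope.

(** Put a = phi y - phi x - p.(y - x) and b = phi x - phi y - q.(x - y), both
    nonnegative. Then a + b = (p - q).(x - y), so the two inequalities say
    a <= K b and b <= K a: each is soft engulfing as the height of the section
    decreases to b, respectively a. *)

Lemma dotBl (R : realType) (n : nat) (u v w : 'rV[R]_n) :
  dot (u - v) w = dot u w - dot v w.
Proof.
by rewrite /dot -sumrB; apply: eq_bigr => i _; rewrite !mxE mulrBl.
Qed.

Lemma dotNr (R : realType) (n : nat) (u v : 'rV[R]_n) :
  dot u (- v) = - dot u v.
Proof.
by rewrite /dot -sumrN; apply: eq_bigr => i _; rewrite !mxE mulrN.
Qed.

(** By contradiction: with [a] and [b] as above, if K a < b then y lies in the section at x of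
    height b / K, so engulfing puts x in the section at y of height K (b / K) = b, which says b <
    b. *)
Lemma soft_engulfing_gap (R : realType) (n : nat) (K : R)
    (phi : 'rV[R]_n -> R) (x y p q : 'rV[R]_n) :
  0 < K -> soft_engulfing K phi ->
  subdifferential phi x p -> subdifferential phi y q ->
  phi x - phi y - dot q (x - y) <= K * (phi y - phi x - dot p (y - x)).
Proof.
move=> K0 soft hp hq; rewrite leNgt; apply/negP.
set a := phi y - _ - _; set b := phi x - _ - _ => Kab.
(* The subgradient inequality at x makes the height b / K > a positive, as engulfing requires. *)
have a0 : 0 <= a by have := hp y; rewrite /a; lra.
have ab : a < b / K by rewrite ltr_pdivlMr // mulrC.
have := soft x p (b / K) hp (le_lt_trans a0 ab) y ab q hq.
by rewrite /section /= mulrCA divff ?gt_eqF // mulr1 ltxx.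
Qed.

Theorem proposition2p1 (R : realType) (n : nat) (hn : (1 <= n)%N)
    (K : R) (hK : 1 < K) (phi : 'rV[R]_n -> R) (hphi : Esoft n K phi)
    (x y p q : 'rV[R]_n)
    (hp : subdifferential phi x p) (hq : subdifferential phi y q) :
  (K + 1) / K * (phi y - phi x - dot p (y - x)) <= dot (p - q) (x - y)
  /\ dot (p - q) (x - y) <= (K + 1) * (phi y - phi x - dot p (y - x)).
Proof.
case: hphi => _ soft.
have K0 : 0 < K by apply: lt_trans hK.
have ba := soft_engulfing_gap R n K phi x y p q K0 soft hp hq.
(* Exchanging (x, p) and (y, q) gives a <= K b. *)
have ab := soft_engulfing_gap R n K phi y x q p K0 soft hq hp.
have -> : dot (p - q) (x - y) = (phi y - phi x - dot p (y - x))
                              + (phi x - phi y - dot q (x - y)).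
  by rewrite dotBl -(opprB x y) dotNr; ring.
move: ba ab; set a := phi y - _ - _; set b := phi x - _ - _ => ba ab.
(* The upper bound a + b <= (K + 1) a is b <= K a; the lower one, multiplied by K, is a <= K b. *)
split; last by lra.
by rewrite mulrAC ler_pdivrMr //; lra.
Qed.
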